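(* Let $H$ be a hypergraph. For each unit $W_E$ in $H$ with $|W_E|>1$, the adjacency matrix $A_{(w,H)}$ has an eigenvalue $-(s_u,s_v)_w$ of multiplicity $|W_E|-1$, where $u,v\in W_E$ with $v\neq u$.
   Context: A hypergraph $H$ is a pair $(V(H),E(H))$ with $V(H)$ a non-empty set (vertices) and $E(H)$ a set of non-empty subsets of $V(H)$ (hyperedges). The edge-vertex incidence matrix $B_H=[b_{ev}]_{e\in E(H),v\in V(H)}$ has $b_{ev}=1$ if $v\in e$ and $b_{ev}=0$ otherwise. For $v\in V(H)$, $s_v:E(H)\to\mathbb{C}$ denotes the column of $B_H$ indexed by $v$. Let $w:E(H)\to(0,\infty)$ be a positive-valued function. For $x,y:E(H)\to\mathbb{C}$, $(x,y)_w=\sum_{e\in E(H)}w(e)x(e)y(e)$. The star of a vertex $v$ is $E_v(H)=\{e\in E(H): v\in e\}$. A unit in $H$ is an equivalence class of the equivalence relation $\{(u,v)\in V(H)\times V(H): E_u(H)=E_v(H)\}$; $W_E$ denotes the unit all of whose vertices have star $E\subseteq E(H)$. $A_{(w,H)}=[a_{uv}]_{u,v\in V(H)}$ is the matrix with $a_{uv}=\sum_{e\in E_u(H)\cap E_v(H)}w(e)$ for distinct $u,v$ and zero diagonal entries.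
   Formalization: Hypergraphs are finite, and ''of multiplicity |W_E|-1'' is read as ''at least |W_E|-1'' (geometric and algebraic): exact multiplicity fails for two disjoint 2-vertex edges with w = 1, where -1 has multiplicity 2 but each unit has size 2. *)

(* Defs.v *)
From HB Require Import structures.
From mathcomp Require Import all_boot all_order all_algebra.
From mathcomp Require Import reals.
From mathcomp.real_closed Require Import complex.

Set Implicit Arguments.
Unset Strict Implicit.
Unset Printing Implicit Defensive.

Import Order.TTheory GRing.Theory Num.Theory.
Local Open Scope ring_scope.

(* Hypergraphs are finite: the matrices and sums below presuppose it. *)
Record hypergraph := Hypergraph {
  vertex : finType;
  edges : {set {set vertex}};
  vertex_nonempty : (0 < #|vertex|)%N;
  edges_nonempty : set0 \notin edges
}.

Definition edge (H : hypergraph) : finType :=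
  {e : {set vertex H} | e \in edges H}.

Definition star (H : hypergraph) (v : vertex H) : {set edge H} :=
  [set e : edge H | v \in val e].

Definition units (H : hypergraph) : {set {set vertex H}} :=
  equivalence_partition (fun u v : vertex H => star u == star v) setT.

(* Rows and columns of matrices are indexed through the enumerations of the
   finite types [edge H] and [vertex H]. *)
Definition incidence (R : realType) (H : hypergraph) :
    'M[R[i]]_(#|edge H|, #|vertex H|) :=
  \matrix_(i < #|edge H|, j < #|vertex H|) (enum_val j \in val (enum_val i))%:R.

Definition incidence_col (R : realType) (H : hypergraph) (v : vertex H) :
    edge H -> R[i] :=
  fun e => incidence R H (enum_rank e) (enum_rank v).

(* Bilinear, not sesquilinear: there is no conjugation. *)
Definition wform (R : realType) (H : hypergraph) (w : edge H -> R)
    (x y : edge H -> R[i]) : R[i] :=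
  \sum_(e : edge H) (w e)%:C%C * x e * y e.

Definition adjacency (R : realType) (H : hypergraph) (w : edge H -> R) :
    'M[R[i]]_#|vertex H| :=
  \matrix_(i < #|vertex H|, j < #|vertex H|)
    if i == j then 0
    else \sum_(e in star (enum_val i) :&: star (enum_val j)) (w e)%:C%C.

(* Main.v *)
Require Import Defs.
From HB Require Import structures.
From mathcomp Require Import all_boot all_order all_algebra.
From mathcomp Require Import reals.
From mathcomp.real_closed Require Import complex.

(** The diagonal of the adjacency matrix A is zero, but for vertices of a unit
    the missing diagonal entry is exactly what the shift by the eigenvalue
    supplies.  Write S for the form of s_u and s_v, that is, the total weight
    of the common star of the unit W.  If x is in W, then every entry of row x
    of A + S I, the diagonal one included, is the total weight of the edges
    through x and the column vertex, so row x depends on x only through its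
    star.  Hence A + S I has |W| equal rows ([adjacency_shift_row]), its rank
    drops by at least |W| - 1 ([mxrank_equal_rows]), and its kernel, the
    eigenspace of A at - S, has dimension at least |W| - 1 >= 1.  The algebraic
    multiplicity is then bounded below by the geometric one
    ([geometric_le_algebraic]). *)

Set Implicit Arguments.
Unset Strict Implicit.
Unset Printing Implicit Defensive.

Import Order.TTheory GRing.Theory Num.Theory.
Local Open Scope ring_scope.

(** Deleting all but one of the equal rows leaves the row space unchanged. *)
Lemma mxrank_equal_rows (F : fieldType) m n (M : 'M[F]_(m, n))
    (S : {set 'I_m}) :
    {in S &, forall i j, row i M = row j M} ->
  (\rank M <= m - (#|S| - 1))%N.
Proof.
move=> eqM; have [->|[i0 Si0]] := set_0Vmem S.
  by rewrite cards0 sub0n subn0 rank_leq_row.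
(* The row i0 stands for all the rows indexed by S. *)
pose T := ~: (S :\ i0).
have <- : #|T| = (m - (#|S| - 1))%N.
  by rewrite cardsCs setCK card_ord (cardsD1 i0 S) Si0 add1n subn1.
pose N := rowsub (fun k : 'I_#|T| => enum_val k) M.
apply: leq_trans (rank_leq_row N); apply/mxrankS/row_subP => i.
have TN j : j \in T -> (row j M <= N)%MS.
  move=> Tj; rewrite -[j](enum_rankK_in Tj Tj) -row_rowsub.
  exact: row_sub.
have [/TN//|] := boolP (i \in T).
rewrite !inE negbK => /andP[_ Si]; rewrite (eqM i i0) //.
by apply: TN; rewrite !inE eqxx.
Qed.

(** With M = A - a I of rank r, row reduction gives an invertible P such that
    the last n - r rows of P M vanish; the corresponding rows of
    P (X I - A) = (X - a) P - P M are multiples of X - a.  Pulling these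
    factors out of the determinant shows that (X - a)^(n - r) divides the
    characteristic polynomial up to the constant det P. *)
Lemma geometric_le_algebraic (F : fieldType) n (A : 'M[F]_n) (a : F) :
  (\rank (eigenspace A a) <= mup a (char_poly A))%N.
Proof.
rewrite mup_geq ?monic_neq0 ?char_poly_monic // mxrank_ker.
set M := A - a%:M; set r := \rank M.
pose P := invmx (col_ebase M).
have Pu : P \in unitmx by rewrite unitmx_inv col_ebase_unit.
have PM : P *m M = pid_mx r *m row_ebase M.
  by rewrite -{1}(mulmx_ebase M) -mulmxA mulKmx ?col_ebase_unit.
have PM0 (i : 'I_n) j : (r <= i)%N -> (P *m M) i j = 0.
  move=> le_ri; rewrite PM mxE big1 // => k _.
  by rewrite mxE ltnNge le_ri andbF mul0r.
pose Pp := map_mx (@polyC F) P.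
pose B := Pp *m char_poly_mx A.
have BE : B = ('X - a%:P) *: Pp - map_mx polyC (P *m M).
  rewrite /B /char_poly_mx map_mxM map_mxB map_scalar_mx /= mulmxBr.
  by rewrite mulmxBr !mul_mx_scalar scalerBl opprB addrA subrK.
(* B = diag D * Q displays the factors X - a of the rows i >= r of B. *)
pose D : 'rV[{poly F}]_n := \row_i (if (r <= i)%N then 'X - a%:P else 1).
pose Q := \matrix_(i, j) (if (r <= i)%N then Pp i j else B i j).
have BDQ : B = diag_mx D *m Q.
  apply/matrixP=> i j; rewrite mul_diag_mx [RHS]mxE [D _ _]mxE [Q _ _]mxE.
  case: leqP => [le_ri|]; last by rewrite mul1r.
  have -> : B i j = ('X - a%:P) * Pp i j - ((P *m M) i j)%:P.
    by rewrite BE !mxE.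
  by rewrite PM0 // subr0.
have detD : \det (diag_mx D) = ('X - a%:P) ^+ (n - r).
  rewrite det_diag; under eq_bigr => i _ do rewrite mxE.
  by rewrite -big_mkcond -(big_geq_mkord _ _ xpredT (fun=> _)) prodr_const_nat.
have : ('X - a%:P) ^+ (n - r) %| \det B by rewrite BDQ det_mulmx detD dvdp_mulr.
rewrite det_mulmx det_map_mx mul_polyC dvdpZr //.
by rewrite -unitfE -unitmxE.
Qed.

Lemma wform_incidence (R : realType) (H : hypergraph) (w : edge H -> R)
    (u v : vertex H) :
  wform w (incidence_col R u) (incidence_col R v) =
  \sum_(e in star u :&: star v) (w e)%:C%C.
Proof.
rewrite /wform [RHS]big_mkcond /=; apply: eq_bigr => e _.
rewrite /incidence_col !mxE !enum_rankK !inE.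
by do 2!case: (_ \in _); rewrite ?mulr1 ?mulr0 ?mul0r.
Qed.

Lemma unit_starE (H : hypergraph) (W : {set vertex H}) (u v : vertex H) :
  W \in units H -> u \in W -> v \in W -> star u = star v.
Proof.
case/imsetP => x _ ->; rewrite !inE /=.
by move=> /eqP <- /eqP <-.
Qed.

(** Off the diagonal the shift contributes nothing; on the diagonal the column
    vertex has the same star as u, so the intersection is the whole star of u,
    whose weight is the shift. *)
Lemma adjacency_shift_row (R : realType) (H : hypergraph) (w : edge H -> R)
    (u : vertex H) (i j : 'I_#|vertex H|) :
    star (enum_val i) = star u ->
  (adjacency w + (\sum_(e in star u) (w e)%:C%C)%:M) i j =
  \sum_(e in star u :&: star (enum_val j)) (w e)%:C%C.
Proof.
move=> su; rewrite !mxE su; case: eqVneq => [<-|_].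
  by rewrite su setIid add0r.
by rewrite addr0.
Qed.

Theorem theorem3p5 (R : realType) (H : hypergraph) (w : edge H -> R)
    (w_gt0 : forall e : edge H, 0 < w e)
    (W : {set vertex H}) (W_unit : W \in units H) (W_gt1 : (1 < #|W|)%N)
    (u v : vertex H) (uW : u \in W) (vW : v \in W) (vNu : v != u) :
  let a := - wform w (incidence_col R u) (incidence_col R v) in
  [/\ eigenvalue (adjacency w) a,
      (#|W| - 1 <= \rank (eigenspace (adjacency w) a))%N &
      (#|W| - 1 <= mup a (char_poly (adjacency w)))%N].
Proof.
move=> a.
have starW x : x \in W -> star x = star u.
  by move=> xW; apply: unit_starE W_unit xW uW.
have aE : a = - \sum_(e in star u) (w e)%:C%C.
  by rewrite /a wform_incidence (starW v vW) setIid.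
have dimW : (#|W| - 1 <= \rank (eigenspace (adjacency w) a))%N.
  pose S := enum_rank @: W.
  have cardS : #|S| = #|W| by rewrite card_imset //; apply: enum_rank_inj.
  have rowS : {in S &, forall i j, row i (adjacency w - a%:M) =
                                   row j (adjacency w - a%:M)}.
    move=> _ _ /imsetP[x xW ->] /imsetP[y yW ->]; apply/rowP => k.
    rewrite aE raddfN opprK [LHS]mxE [RHS]mxE.
    by rewrite !(adjacency_shift_row _ (u := u)) // enum_rankK starW.
  have := mxrank_equal_rows rowS; rewrite cardS mxrank_ker => rk.
  have Wn : (#|W| - 1 <= #|vertex H|)%N.
    by rewrite (leq_trans (leq_subr _ _)) ?max_card.
  by rewrite -(subKn Wn) leq_sub2l.
split=> //; last exact: leq_trans dimW (geometric_le_algebraic _ _).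
by rewrite /eigenvalue -mxrank_eq0 -lt0n (leq_trans _ dimW) // subn_gt0.
Qed.
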